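(* Let $L$ be a finite-dimensional Lie algebra over an algebraically closed field of characteristic $0$, and let $J$ be a Lie-orthogonal operator on $L$ all of whose eigenvalues differ from $1$ and $-1$. Then $L$ is a solvable Lie algebra of solvability degree not greater than two, i.e., $[[L,L],[L,L]]=\{0\}$.
   Context: A linear operator $J$ on a Lie algebra $L$ is called Lie-orthogonal if $[Jx,Jy]=[x,y]$ for all $x,y\in L$. *)

(* Defs.v *)
From HB Require Import structures.
From mathcomp Require Import all_boot all_order all_algebra.

Set Implicit Arguments.
Unset Strict Implicit.
Unset Printing Implicit Defensive.

Import GRing.Theory.
Local Open Scope ring_scope.

HB.mixin Record isLieAlgebra (F : fieldType) L of Vector F L := {
  lie : L -> L -> L;
  lie_linearl : forall y : L, linear (lie^~ y);
  lie_linearr : forall x : L, linear (lie x);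
  liexx : forall x : L, lie x x = 0;
  lie_jacobi : forall x y z : L,
    lie x (lie y z) + lie y (lie z x) + lie z (lie x y) = 0
}.

(* Finite-dimensional Lie algebras over F. *)
#[short(type="lieAlgType")]
HB.structure Definition LieAlgebra (F : fieldType) :=
  {L of isLieAlgebra F L & Vector F L}.

Notation "[ 'lie' x , y ]" := (lie x y)
  (at level 0, x, y at level 99, format "[ 'lie'  x ,  y ]") : ring_scope.

Section Brackets.

Variables (F : fieldType) (L : lieAlgType F).
Implicit Types (U V W : {vspace L}) (J : 'End(L)) (n : nat).

(* [U, V] is the span of all brackets [u, v] with u in U and v in V. As for
   prodv, it is generated by brackets of basis vectors; memv_lie and liesvP
   show that it is the least subspace containing every such [u, v]. *)
Definition liesv U V : {vspace L} :=
  <<[seq [lie u, v] | u <- vbasis U, v <- vbasis V]>>%VS.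

Definition lie_derived n : {vspace L} := iter n (fun U => liesv U U) fullv.

Definition lie_solvability_degree n : Prop :=
  lie_derived n = 0%VS /\ forall m, (m < n)%N -> lie_derived m <> 0%VS.

Definition lie_orthogonal J : Prop :=
  forall x y : L, [lie J x, J y] = [lie x, y].

Lemma lie_suml I (r : seq I) (f : I -> L) (y : L) :
  [lie \sum_(i <- r) f i, y] = \sum_(i <- r) [lie f i, y].
Proof.
have lie0 : [lie (0 : L), y] = 0.
  by have := lie_linearl y (-1) 0 0; rewrite !scaleN1r !addNr.
elim: r => [|i r IHr]; first by rewrite !big_nil.
by rewrite !big_cons -{1}(scale1r (f i)) lie_linearl scale1r IHr.
Qed.

Lemma lie_sumr I (r : seq I) (f : I -> L) (x : L) :
  [lie x, \sum_(i <- r) f i] = \sum_(i <- r) [lie x, f i].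
Proof.
have lie0 : [lie x, 0] = 0.
  by have := lie_linearr x (-1) 0 0; rewrite !scaleN1r !addNr.
elim: r => [|i r IHr]; first by rewrite !big_nil.
by rewrite !big_cons -{1}(scale1r (f i)) lie_linearr scale1r IHr.
Qed.

Lemma lieZl a (x y : L) : [lie a *: x, y] = a *: [lie x, y].
Proof.
have := lie_linearl y a x 0; rewrite addr0 => ->.
by have := lie_linearl y (-1) 0 0; rewrite !scaleN1r !addNr => ->; rewrite addr0.
Qed.

Lemma lieZr a (x y : L) : [lie x, a *: y] = a *: [lie x, y].
Proof.
have := lie_linearr x a y 0; rewrite addr0 => ->.
by have := lie_linearr x (-1) 0 0; rewrite !scaleN1r !addNr => ->; rewrite addr0.
Qed.

Lemma memv_lie U V (u v : L) :
  u \in U -> v \in V -> [lie u, v] \in liesv U V.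
Proof.
move=> /coord_vbasis-> /coord_vbasis->.
rewrite lie_suml; apply: rpred_sum => i _.
rewrite lie_sumr; apply: rpred_sum => j _.
rewrite lieZl lieZr !rpredZ // memv_span //.
by apply: allpairs_f; apply: mem_nth; rewrite size_tuple.
Qed.

Lemma liesvP U V W :
  (forall u v : L, u \in U -> v \in V -> [lie u, v] \in W)
    <-> (liesv U V <= W)%VS.
Proof.
split=> [sUVW | /subvP sUVW u v uU vV]; last exact/sUVW/memv_lie.
apply/span_subvP => _ /allpairsP[[u v] /= [/vbasis_mem uU /vbasis_mem vV ->]].
exact: sUVW.
Qed.

End Brackets.

Notation "[ 'liesv' U , V ]" := (liesv U V)
  (at level 0, U, V at level 99, format "[ 'liesv'  U ,  V ]") : vspace_scope.

(* Main.v *)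
(* If a b <> 1, then the bracket of the generalized eigenspaces of J for a and
   b vanishes, since J (x) J has only the eigenvalue a b on their tensor
   product. As neither 1 nor -1 is an eigenvalue, each pair {a, a^-1} has two
   distinct members; sorting the eigenvalues into two classes, neither of which
   contains both members of a pair, writes L as a sum of two abelian subspaces.
   Ito's commutator identity then makes the derived algebra abelian. *)
Require Import Defs.
From HB Require Import structures.
From mathcomp Require Import all_boot all_order all_algebra.

Set Implicit Arguments.
Unset Strict Implicit.
Unset Printing Implicit Defensive.

Import GRing.Theory passmx.
Local Open Scope ring_scope.

(** * Bracket calculus and sums of two abelian subspaces *)

Section LieTheory.

Variables (F : fieldType) (L : lieAlgType F).
Implicit Types (x y z : L) (U V : {vspace L}).

HB.instance Definition _ x :=
  GRing.isLinear.Build F L L _ (@lie F L x) (lie_linearr x).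

Lemma lieDl x y z : [lie x + y, z] = [lie x, z] + [lie y, z].
Proof. by have := lie_linearl z 1 x y; rewrite !scale1r. Qed.

Lemma lieDr x y z : [lie x, y + z] = [lie x, y] + [lie x, z].
Proof. exact: linearD. Qed.

Lemma lie0r x : [lie x, 0] = 0.
Proof. exact: linear0. Qed.

Lemma lieNr x y : [lie x, - y] = - [lie x, y].
Proof. exact: linearN. Qed.

Lemma lieC x y : [lie x, y] = - [lie y, x].
Proof.
apply/eqP; rewrite -addr_eq0; apply/eqP.
by have := liexx (x + y); rewrite lieDl !lieDr !liexx add0r addr0.
Qed.

Lemma lie0l x : [lie 0, x] = 0.
Proof. by rewrite lieC lie0r oppr0. Qed.

(** The Jacobi identity, read through antisymmetry as: [lie x] is a derivation. *)
Lemma lie_leibniz x y z :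
  [lie x, [lie y, z]] = [lie [lie x, y], z] + [lie y, [lie x, z]].
Proof.
apply/eqP; rewrite -subr_eq0 opprD addrA addrAC -lieNr -(lieC z x).
by rewrite -(lieC z [lie x, y]) lie_jacobi.
Qed.

Lemma liesv_eq0 U V :
  (forall x y, x \in U -> y \in V -> [lie x, y] = 0) -> liesv U V = 0%VS.
Proof.
move=> UV0; apply/eqP; rewrite -subv0; apply/liesvP => x y xU yV.
by rewrite UV0 ?mem0v.
Qed.

(** The kernel of [lie x] is a subspace, so it contains [liesv U V] as soon as it contains the
    generating brackets. *)
Lemma lie_liesv_eq0 U V x :
  (forall u v, u \in U -> v \in V -> [lie x, [lie u, v]] = 0) ->
  forall y, y \in liesv U V -> [lie x, y] = 0.
Proof.
move=> xUV0 y; have: (liesv U V <= lker (linfun (lie x)))%VS.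
  by apply/liesvP => u v uU vV; rewrite memv_ker lfunE /= xUV0.
by move=> /subvP/[apply]; rewrite memv_ker lfunE /= => /eqP.
Qed.

Section SumOfAbelian.

Variables U V : {vspace L}.
Hypothesis U_abelian : forall x y, x \in U -> y \in U -> [lie x, y] = 0.
Hypothesis V_abelian : forall x y, x \in V -> y \in V -> [lie x, y] = 0.
Hypothesis UV_full : (U + V)%VS = fullv.

Lemma liesv_sum_abelian : (liesv {:L} {:L} <= liesv U V)%VS.
Proof.
apply/liesvP => x y _ _.
have /memv_addP[u uU [v vV ->]] : x \in (U + V)%VS by rewrite UV_full memvf.
have /memv_addP[u' uU' [v' vV' ->]] : y \in (U + V)%VS by rewrite UV_full memvf.
rewrite lieDl !lieDr (U_abelian uU uU') (V_abelian vV vV') add0r addr0 (lieC v).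
by rewrite rpredB ?memv_lie.
Qed.

(** Split [u, v'] = a + b and [v, u'] = c + d along U + V. The bracket is the difference of [u, [v,
    [u', v']]] and [v, [u, [u', v']]], and the derivation rule reduces each of these to [c, b]. *)
Lemma Ito_identity u v u' v' : u \in U -> v \in V -> u' \in U -> v' \in V ->
  [lie [lie u, v], [lie u', v']] = 0.
Proof.
move=> uU vV uU' vV'.
have /memv_addP[a aU [b bV uv'E]] : [lie u, v'] \in (U + V)%VS.
  by rewrite UV_full memvf.
have /memv_addP[c cU [d dV u'vE]] : [lie v, u'] \in (U + V)%VS.
  by rewrite UV_full memvf.
have -> : [lie [lie u, v], [lie u', v']] =
    [lie u, [lie v, [lie u', v']]] - [lie v, [lie u, [lie u', v']]].
  by rewrite (lie_leibniz u) addrK.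
rewrite (lie_leibniz v u') u'vE (V_abelian vV vV') lie0r addr0.
rewrite lieDl (V_abelian dV vV') addr0.
rewrite (lie_leibniz u c) (U_abelian uU cU) lie0l add0r.
rewrite (lie_leibniz u u') (U_abelian uU uU') lie0l add0r uv'E.
rewrite !lieDr (U_abelian cU aU) (U_abelian uU' aU) ?lie0r !add0r.
rewrite (lie_leibniz v) u'vE (V_abelian vV bV) lie0r addr0 lieDl.
by rewrite (V_abelian dV bV) addr0 subrr.
Qed.

Lemma liesv_liesv_sum_abelian :
  liesv (liesv {:L} {:L}) (liesv {:L} {:L}) = 0%VS.
Proof.
apply: liesv_eq0 => x y /(subvP liesv_sum_abelian) xUV.
move=> /(subvP liesv_sum_abelian); apply: lie_liesv_eq0 => u v uU vV.
(* The second argument is now a generator; antisymmetry lets the first be reduced in the same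
   way. *)
rewrite lieC (@lie_liesv_eq0 U V) ?oppr0 // => u' v' uU' vV'.
exact: Ito_identity.
Qed.

End SumOfAbelian.

Lemma lie_solvability_degree_exists n : lie_derived L n = 0%VS ->
  exists2 d : nat, lie_solvability_degree L d & (d <= n)%N.
Proof.
move=> Ln0; have ex0 : exists m, lie_derived L m == 0%VS by exists n; apply/eqP.
case: (ex_minnP ex0) => d /eqP Ld0 min_d; exists d; last exact/min_d/eqP.
by split=> // m lt_md /eqP/min_d; rewrite leqNgt lt_md.
Qed.

End LieTheory.

(** * Kernels of products of linear factors *)

Section KermxpolyRoots.

Variable F : fieldType.
Implicit Types (n : nat) (s : seq F).

Lemma kermxpoly_XsubCM n (M : 'M[F]_n) a p (u : 'rV_n) :
  (u <= kermxpoly M (('X - a%:P) * p))%MS ->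
  (u *m M - a *: u <= kermxpoly M p)%MS.
Proof.
case: n => [|n] in M u *; first by rewrite !thinmx0 sub0mx.
move=> /sub_kermxP; rewrite rmorphM /= rmorphB /= horner_mx_X horner_mx_C.
rewrite -mulmxE mulmxA => up0; apply/sub_kermxP.
by rewrite -mul_mx_scalar -mulmxBr.
Qed.

(** Primary decomposition: [P] puts all copies of a repeated root on the same side, so the two
    subproducts are coprime. *)
Lemma kermxpoly_split n (M : 'M[F]_n) (P : pred F) s :
  (kermxpoly M (\prod_(a <- s) ('X - a%:P)) <=
    kermxpoly M (\prod_(a <- s | P a) ('X - a%:P)) +
    kermxpoly M (\prod_(a <- s | ~~ P a) ('X - a%:P)))%MS.
Proof.
rewrite (bigID P) /= -kermxpolyM ?submx_refl //.
apply: (big_ind (coprimep _)) => [|p q | b nPb]; first exact: coprimep1.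
  by rewrite coprimepMr => -> ->.
by rewrite coprimep_XsubC -big_filter root_prod_XsubC mem_filter negb_and nPb.
Qed.

End KermxpolyRoots.

(** [s] lists the roots of the minimal polynomial with multiplicity; that polynomial annihilates
    [M]. *)
Lemma mxminpoly_roots (F : closedFieldType) n (M : 'M[F]_n) :
  exists2 s : seq F, {subset s <= eigenvalue M}
    & (1%:M <= kermxpoly M (\prod_(a <- s) ('X - a%:P)))%MS.
Proof.
case: n => [|n] in M *; first by exists [::] => //; rewrite thinmx0 sub0mx.
have [s] := closed_field_poly_normal (mxminpoly M).
rewrite (monicP (mxminpoly_monic M)) scale1r => sE; exists s.
  by move=> a; rewrite -root_prod_XsubC -sE -eigenvalue_root_min.
by rewrite -sE (kermxpoly_min (dvdpp _)).
Qed.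

(** * Generalized eigenspaces of a Lie-orthogonal operator *)

Section LieOrthogonal.

Variables (F : fieldType) (L : lieAlgType F) (J : 'End(L)).
Variable e : (\dim {:L}).-tuple L.
Hypothesis e_basis : basis_of {:L} e.
Hypothesis J_orth : lie_orthogonal J.

Local Notation M := (mxof e e J).
Local Notation vec := (vecof e).

Lemma leigenvalue_mxof a : eigenvalue M a -> leigenvalue J a.
Proof.
move=> /eigenvalueP[u uM u_neq0]; apply: contraNneq u_neq0 => /vspaceP ker0.
rewrite -(vecof_eq0 e_basis) -memv0 -ker0 memv_ker !lfun_simp.
by rewrite (hom_vecof e e_basis) uM linearZ subrr.
Qed.

(** Nested induction on [s] and [t]. With u' = (J - a)u and v' = (J - b)v, [Ju, Jv] expands to
    ab[u, v] plus brackets involving u' or v'. These vanish by induction, so orthogonality leaves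
    (ab - 1)[u, v] = 0. *)
Lemma lie_kermxpoly (s t : seq F) (u v : 'rV_(\dim {:L})) :
    {in s & t, forall a b, a * b != 1} ->
    (u <= kermxpoly M (\prod_(a <- s) ('X - a%:P)))%MS ->
    (v <= kermxpoly M (\prod_(b <- t) ('X - b%:P)))%MS ->
  [lie vec u, vec v] = 0.
Proof.
elim: s t u v => [|a s IHs] t u v.
  by rewrite big_nil kermxpoly1 submx0 => _ /eqP-> _; rewrite linear0 lie0l.
elim: t u v => [|b t IHt] u v st_neq1.
  by rewrite big_nil kermxpoly1 submx0 => _ /eqP->; rewrite linear0 lie0r.
move=> u_ker v_ker.
have u'_ker := u_ker; rewrite big_cons in u'_ker.
have v'_ker := v_ker; rewrite big_cons in v'_ker.
move: (kermxpoly_XsubCM u'_ker) (kermxpoly_XsubCM v'_ker).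
set u' := u *m M - _; set v' := v *m M - _ => {}u'_ker {}v'_ker.
have JuE : J (vec u) = vec u' + a *: vec u.
  by rewrite (hom_vecof e e_basis) // -linearZ -linearD subrK.
have JvE : J (vec v) = vec v' + b *: vec v.
  by rewrite (hom_vecof e e_basis) // -linearZ -linearD subrK.
(* Passing to u' drops the factor of a, so the outer hypothesis applies with the second list kept
   whole; passing to v' below uses the inner one. *)
have u'w w : (w <= kermxpoly M (\prod_(b <- b :: t) ('X - b%:P)))%MS ->
    [lie vec u', vec w] = 0.
  by apply: IHs u'_ker => c d cs; apply: st_neq1; rewrite inE cs orbT.
have uv' : [lie vec u, vec v'] = 0.
  by apply: IHt v'_ker => // c d cs dt; apply: st_neq1; rewrite // inE dt orbT.
have u'v' : [lie vec u', vec v'] = 0.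
  apply: IHs u'_ker v'_ker => c d cs dt.
  by apply: st_neq1; rewrite inE ?cs ?dt orbT.
have := J_orth (vec u) (vec v); rewrite JuE JvE !lieDl !lieDr u'v'.
rewrite lieZr (u'w v) // !lieZl uv' lieZr !scaler0 !add0r scalerA.
move=> /eqP; rewrite -subr_eq0 -{2}(scale1r [lie vec u, vec v]) -scalerBl.
rewrite scaler_eq0 subr_eq0 (negPf (st_neq1 a b _ _)) ?inE ?eqxx //.
by move/eqP.
Qed.

End LieOrthogonal.

Lemma split_inverse_pairs (F : fieldType) (s : seq F) :
    {in s, forall a, a != 1 /\ a != -1} ->
  exists P : pred F,
    {in [seq a <- s | P a] &, forall a b, a * b != 1} /\
    {in [seq a <- s | ~~ P a] &, forall a b, a * b != 1}.
Proof.
(* P keeps from each pair {a, a^-1} the member occurring first in s. *)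
move=> s_neq; exists (fun a => index a s <= index a^-1 s)%N.
split=> a b; rewrite !mem_filter => /andP[Pa sa] /andP[Pb sb];
  apply/negP => /eqP ab1; have aV : a^-1 = b by exact: mulr1_eq.
  move: Pb Pa; rewrite -aV invrK => le1 le2.
  (* Both members chosen: they first occur at the same place, so a is its own inverse and a^2 = 1,
     which is excluded. *)
  have /eqP eq_i : index a s == index a^-1 s by rewrite eqn_leq le2.
  have aVa : a = a^-1 by rewrite -[LHS](nth_index 0 sa) eq_i nth_index ?aV.
  have /orP[] : (a == 1) || (a == -1) by rewrite -sqrf_eq1 expr2 {2}aVa aV ab1.
    by apply/negP; case: (s_neq a sa).
  by apply/negP; case: (s_neq a sa).
(* Both members rejected: each would occur strictly before the other. *)
move: Pb Pa; rewrite -aV invrK -!ltnNge => lt1 lt2.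
by have := ltn_trans lt1 lt2; rewrite ltnn.
Qed.

Theorem theorem1 (F : closedFieldType) (charF0 : [pchar F] =i pred0)
    (L : lieAlgType F) (J : 'End(L)) (J_orth : lie_orthogonal J)
    (J_eigen : forall a : F, passmx.leigenvalue J a -> a != 1 /\ a != -1) :
  (exists2 d : nat, lie_solvability_degree L d & (d <= 2)%N) /\
  [liesv [liesv {:L}, {:L}], [liesv {:L}, {:L}]]%VS = 0%VS.
Proof.
suffices L2_0: [liesv [liesv {:L}, {:L}], [liesv {:L}, {:L}]]%VS = 0%VS.
  (* [lie_derived L 2] unfolds to this double bracket. *)
  by split=> //; apply: lie_solvability_degree_exists.
have e_basis := vbasisP {:L}; set e := vbasis _ in e_basis.
have [s s_eig s_full] := mxminpoly_roots (mxof e e J).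
have [|P [P_neq1 nP_neq1]] := @split_inverse_pairs F s.
  by move=> a /s_eig/(leigenvalue_mxof e_basis)/J_eigen.
(* In coordinates, the sum of the generalized eigenspaces of [J] for the members of [s] satisfying
   [Q]. *)
pose K (Q : pred F) := kermxpoly (mxof e e J)
  (\prod_(a <- s | Q a) ('X - a%:P)).
have K_abelian Q : {in [seq a <- s | Q a] &, forall a b, a * b != 1} ->
    forall x y, x \in vsof e (K Q) -> y \in vsof e (K Q) ->
  [lie x, y] = 0.
  rewrite /K -big_filter => Q_neq1 x y.
  rewrite -!(rVof_sub e_basis) => xK yK.
  rewrite -(rVofK e_basis x) -(rVofK e_basis y).
  exact: (lie_kermxpoly e_basis J_orth Q_neq1).
apply: (liesv_liesv_sum_abelian (K_abelian _ P_neq1) (K_abelian _ nP_neq1)).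
apply/vspaceP => x; rewrite memvf -(rVofK e_basis x).
have /sub_addsmxP[[u v] /= ->] : (rVof e x <= K P + K (predC P))%MS.
  exact: submx_trans (submx_trans (submx1 _) s_full) (kermxpoly_split _ P s).
rewrite linearD memv_add // -(rVof_sub e_basis).
all: by rewrite (vecofK e_basis) submxMl.
Qed.
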